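(* Let $X$ be a normal modal logic and let $I$ be an index set with $\omega\subseteq I$. Suppose that $X$ is complete with respect to a set of Kripke frames $F=\{(G_\alpha,R_\alpha):\alpha\in I\}$, where for every $\alpha\in I$, $G_\alpha$ is a nonempty infinite set and $R_\alpha$ is an accessibility relation (a binary relation) on $G_\alpha$. Let $H=\{(G_i^*,R_i^* ): i\in\omega\}$ be a set of Kripke frames such that for every $i\in\omega$: $$G_i^*=\{*,g_0,g_1,\dots,g_i\}\cup G_{\omega i},$$ where $G_{\omega i}=\{\eta_{ij}: j\in\omega\}$ has cardinality $\aleph_0$, $\{*,g_0,\dots,g_i\}\cap G_{\omega i}=\emptyset$, the elements $*,g_0,\dots,g_i$ are distinct, and $$R_i^*=\{( *,g_j):0\le j\le i\}\cup\{(\eta,\eta):\eta\in G_{\omega i}\}.$$ If $H\subseteq F$, then $B$-translation is faithful with respect to $X$.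
   Context: The system $\mathbf{L_1}$ (Leśniewski's propositional ontology): fix a countably infinite set of name variables. The atomic formulas are exactly the expressions $\epsilon ab$ with $a,b$ name variables (possibly equal); formulas are built from atomic formulas by $\vee$ and $\neg$, the other connectives being the usual classical abbreviations. $\mathbf{L_1}$ is a Hilbert-style system of classical propositional logic (with modus ponens) over these formulas with the additional axiom schemata, for all name variables $a,b,c$: (Ax1) $\epsilon ab \supset \epsilon aa$; (Ax2) $(\epsilon ab \wedge \epsilon bc) \supset \epsilon ac$; (Ax3) $(\epsilon ab \wedge \epsilon bc) \supset \epsilon ba$. $B$-translation: to each name variable $a$ corresponds a propositional variable $p_a$, with distinct name variables corresponding to distinct propositional variables. $B$ maps formulas of $\mathbf{L_1}$ to propositional modal formulas by $B(\phi\vee\psi)=B(\phi)\vee B(\psi)$, $B(\neg\phi)=\neg B(\phi)$, $B(\epsilon ab)=p_a\wedge\Box(p_a\supset p_b)\wedge\bigl(p_b\supset\Box(p_b\supset p_a)\bigr)$. $B$-translation is faithful with respect to a modal logic $X$ if for every formula $\phi$ of $\mathbf{L_1}$, $\vdash_X B(\phi)$ implies $\vdash_{\mathbf{L_1}}\phi$. A normal modal logic is a set $X$ of propositional modal formulas with $\mathbf{K}\subseteq X$ that is closed under modus ponens, substitution and necessitation. $X$ is complete with respect to a set $F$ of Kripke frames if, for every modal formula $\chi$, $\vdash_X\chi$ holds if and only if $\chi$ is valid in every frame in $F$. *)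

(* Defs.v *)
From mathcomp Require Import all_boot.
From mathcomp Require Import boolp classical_sets functions cardinality.

Set Implicit Arguments.
Unset Strict Implicit.
Unset Printing Implicit Defensive.

Local Open Scope classical_set_scope.

Section Classical.
Variables (F : Type) (neg : F -> F) (or : F -> F -> F).

Definition pimp (A B : F) : F := or (neg A) B.
Definition pconj (A B : F) : F := neg (or (neg A) (neg B)).

(* Axiom schemata which, with modus ponens, axiomatize the classical           *)
(* propositional calculus on the primitives [or] and [neg]. The schemata for   *)
(* [or] are needed although [pimp] is defined from it: the first three do not   *)
(* relate [or A B] to [pimp (neg A) B].                                         *)
Inductive classical_axiom : F -> Prop :=
| CA_K A B : classical_axiom (pimp A (pimp B A))
| CA_S A B C :
    classical_axiom (pimp (pimp A (pimp B C)) (pimp (pimp A B) (pimp A C)))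
| CA_contra A B : classical_axiom (pimp (pimp (neg A) (neg B)) (pimp B A))
| CA_orl A B : classical_axiom (pimp A (or A B))
| CA_orr A B : classical_axiom (pimp B (or A B))
| CA_orE A B C : classical_axiom (pimp (pimp A C) (pimp (pimp B C) (pimp (or A B) C))).

End Classical.

Definition name := nat.

Inductive oform : Type :=
| Oeps of name & name
| Oneg of oform
| Oor of oform & oform.

Definition Oimp : oform -> oform -> oform := pimp Oneg Oor.
Definition Oand : oform -> oform -> oform := pconj Oneg Oor.

Inductive L1 : oform -> Prop :=
| L1_classical A : classical_axiom Oneg Oor A -> L1 A
| L1_ax1 a b : L1 (Oimp (Oeps a b) (Oeps a a))
| L1_ax2 a b c : L1 (Oimp (Oand (Oeps a b) (Oeps b c)) (Oeps a c))
| L1_ax3 a b c : L1 (Oimp (Oand (Oeps a b) (Oeps b c)) (Oeps b a))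
| L1_mp A B : L1 (Oimp A B) -> L1 A -> L1 B.

Definition propvar := nat.

Inductive mform : Type :=
| Mvar of propvar
| Mneg of mform
| Mor of mform & mform
| Mbox of mform.

Definition Mimp : mform -> mform -> mform := pimp Mneg Mor.
Definition Mand : mform -> mform -> mform := pconj Mneg Mor.

Fixpoint msubst (s : propvar -> mform) (A : mform) : mform :=
  match A with
  | Mvar p => s p
  | Mneg B => Mneg (msubst s B)
  | Mor B C => Mor (msubst s B) (msubst s C)
  | Mbox B => Mbox (msubst s B)
  end.

Inductive logicK : mform -> Prop :=
| K_classical A : classical_axiom Mneg Mor A -> logicK A
| K_dist A B : logicK (Mimp (Mbox (Mimp A B)) (Mimp (Mbox A) (Mbox B)))
| K_mp A B : logicK (Mimp A B) -> logicK A -> logicK B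
| K_nec A : logicK A -> logicK (Mbox A).

Definition normal_logic (X : set mform) : Prop :=
  [/\ logicK `<=` X,
      forall A B, X (Mimp A B) -> X A -> X B,
      forall s A, X A -> X (msubst s A)
    & forall A, X A -> X (Mbox A)].

(* Worlds are taken from an ambient type [U], so that frames are literally     *)
(* pairs of sets and inclusion between sets of frames makes sense.             *)
Record kframe (U : Type) : Type := KFrame {
  world : set U;
  acc : set (U * U);
  world_nonempty : world !=set0;
  acc_world : acc `<=` world `*` world
}.

(* Only the values of [V] on [world fr] matter, by [acc_world].                *)
Fixpoint forces (U : Type) (fr : kframe U) (V : propvar -> set U)
    (w : U) (A : mform) : Prop :=
  match A with
  | Mvar p => V p w
  | Mneg B => ~ forces fr V w B
  | Mor B C => forces fr V w B \/ forces fr V w C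
  | Mbox B => forall v, acc fr (w, v) -> forces fr V v B
  end.

Definition valid (U : Type) (fr : kframe U) (A : mform) : Prop :=
  forall (V : propvar -> set U) (w : U), world fr w -> forces fr V w A.

(* "Complete" comprises soundness.                                             *)
Definition complete_wrt (U : Type) (X : set mform) (F : set (kframe U)) : Prop :=
  forall A, X A <-> (forall fr, F fr -> valid fr A).

Fixpoint Btrans (p : name -> propvar) (A : oform) : mform :=
  match A with
  | Oeps a b =>
      let pa := Mvar (p a) in let pb := Mvar (p b) in
      Mand (Mand pa (Mbox (Mimp pa pb))) (Mimp pb (Mbox (Mimp pb pa)))
  | Oneg B => Mneg (Btrans p B)
  | Oor B C => Mor (Btrans p B) (Btrans p C)
  end.

Definition B_faithful (p : name -> propvar) (X : set mform) : Prop :=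
  forall A : oform, X (Btrans p A) -> L1 A.

(* Main.v *)
(** A formula [A] unprovable in L1 is refuted by a relation [e] on names
satisfying Ax1-Ax3 (Lindenbaum). If all names of [A] are at most [i], then
[A] is refuted through the B-translation at the world [*] of [H i]: let the
variable of a name [a] hold at [*] iff [e a a], and at [g j] iff [e j a].
The reflexive worlds are unreachable from [*] and play no role. *)
Require Import Defs.
From mathcomp Require Import all_boot.
From mathcomp Require Import boolp classical_sets functions cardinality.

Set Implicit Arguments.
Unset Strict Implicit.
Unset Printing Implicit Defensive.

Local Open Scope classical_set_scope.

Section Lindenbaum.
Variables (F : Type) (neg : F -> F) (or : F -> F -> F).
Local Notation "A ~> B" := (pimp neg or A B) (at level 55, right associativity).

Definition classical_theory (L : set F) : Prop :=
  classical_axiom neg or `<=` L /\ (forall A B, L (A ~> B) -> L A -> L B).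

Lemma theory_imp_refl (L : set F) (A : F) : classical_theory L -> L (A ~> A).
Proof.
move=> [ax mp]; apply: (mp (A ~> (A ~> A))); last exact/ax/CA_K.
by apply: (mp (A ~> ((A ~> A) ~> A))); [exact/ax/CA_S | exact/ax/CA_K].
Qed.

Lemma theory_weaken (L : set F) (A B : F) :
  classical_theory L -> L B -> L (A ~> B).
Proof. by move=> [ax mp]; apply: mp; exact/ax/CA_K. Qed.

(** By the deduction theorem this set is the theory generated by [L] and [B]; its closure under
    modus ponens is the schema [CA_S]. *)
Lemma theory_adjoin (L : set F) (B : F) :
  classical_theory L -> classical_theory [set C | L (B ~> C)].
Proof.
move=> L_th; have [ax mp] := L_th; split=> [C /ax|C D /= LCD LC].
  exact: theory_weaken.
by apply: (mp (B ~> C)) => //; apply: (mp (B ~> (C ~> D))) => //; exact/ax/CA_S.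
Qed.

(** Zorn's lemma applies because the two premises of a modus ponens already lie in a common member
    of a chain, so theories omitting [A] survive unions. *)
Lemma maximal_theory (L : set F) (A : F) : classical_theory L -> ~ L A ->
  exists M : set F, [/\ L `<=` M, classical_theory M, ~ M A &
    forall N, M `<=` N -> classical_theory N -> ~ N A -> N `<=` M].
Proof.
move=> L_th nLA.
(* [L] is joined in so that the union of the empty chain is admissible. *)
pose P (T : set F) := classical_theory (L `|` T) /\ ~ (L `|` T) A.
have [C CP totC|T [[T_th nTA] Tmax]] := @Zorn_bigcup F P.
  split; last by move=> [//|[T CT TA]]; apply: (CP T CT).2; right.
  split=> [B /L_th.1|B D]; first by left.
  have mpT T : C T -> (L `|` T) (B ~> D) -> (L `|` T) B ->
      (L `|` \bigcup_(X in C) X) D.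
    move=> CT TBD TB; have [|TD] := (CP T CT).1.2 _ _ TBD TB; first by left.
    by right; exists T.
  move=> [LBD|[T CT TBD]] [LB|[T' CT' TB]].
  - by left; exact: L_th.2 LBD LB.
  - by apply: (mpT T') => //; [left|right].
  - by apply: (mpT T) => //; [right|left].
  - have [TT'|T'T] := totC _ _ CT CT'.
      by apply: (mpT T') => //; right => //; exact: TT'.
    by apply: (mpT T) => //; right => //; exact: T'T.
exists (L `|` T); split=> // N MN N_th nNA B NB.
apply: contrapT => nMB; apply: (Tmax N).
  split=> [C TC|NT]; first by apply: MN; right.
  by apply: nMB; right; exact: NT.
(* [N] extends [M], which contains [L], so joining [L] to it changes nothing. *)
suff LN : L `|` N = N by rewrite /P LN.
by apply/seteqP; split=> C; [case=> // LC; apply: MN; left | right].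
Qed.

(** In a theory maximal among those omitting [A], the formula [A] serves as falsum: the [B] outside
    [M] are exactly those with [B ~> A] in [M]. *)
Lemma lindenbaum (L : set F) (A : F) : classical_theory L -> ~ L A ->
  exists M : set F, [/\ L `<=` M, ~ M A, forall B, M (neg B) <-> ~ M B &
    forall B C, M (or B C) <-> M B \/ M C].
Proof.
move=> L_th /(maximal_theory L_th)[M [LM M_th nMA Mmax]].
have [ax mp] := M_th.
have Mimp B : ~ M B -> M (B ~> A).
  move=> nMB; apply: contrapT => nMBA; apply: nMB.
  (* The theory generated by [M] and [B] omits [A], so by maximality it is within [M], yet it
     contains [B]. *)
  apply: (Mmax [set C | M (B ~> C)]) => //.
  - by move=> C; exact: theory_weaken.
  - exact: theory_adjoin.
  - exact: theory_imp_refl.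
have MorA B C : M (or B C) -> M (B ~> A) -> M (C ~> A) -> M A.
  move=> MBC MB MC; apply: (mp (or B C)) => //.
  apply: (mp (C ~> A)) => //; apply: (mp (B ~> A)) => //; exact/ax/CA_orE.
exists M; split=> // [B|B C]; split.
- move=> MnB MB; apply: nMA; apply: (mp B) => //.
  apply: (mp (neg A ~> neg B)); first exact/ax/CA_contra.
  exact: theory_weaken.
- move=> nMB; apply: contrapT => nMnB; apply: nMA.
  (* Excluded middle [or (neg B) B] is by definition [B ~> B]. *)
  by apply: (MorA (neg B) B); [exact: theory_imp_refl | exact: Mimp..].
- move=> MBC; apply: contrapT => /not_orP[nMB nMC].
  by apply: nMA; apply: (MorA B C) => //; exact: Mimp.
- by move=> [MB|MC]; [apply: (mp B) | apply: (mp C)] => //;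
     apply: ax; [exact: CA_orl | exact: CA_orr].
Qed.

End Lindenbaum.

Definition ontological (e : name -> name -> Prop) : Prop :=
  [/\ forall a b, e a b -> e a a,
      forall a b c, e a b -> e b c -> e a c
    & forall a b c, e a b -> e b c -> e b a].

Fixpoint oeval (e : name -> name -> Prop) (A : oform) : Prop :=
  match A with
  | Oeps a b => e a b
  | Oneg B => ~ oeval e B
  | Oor B C => oeval e B \/ oeval e C
  end.

(** The countermodel to an unprovable formula is read off the set [M] of [lindenbaum]: [e a b] means
    that [Oeps a b] belongs to [M], and the axioms in [M] make [e] ontological. *)
Lemma L1_complete (A : oform) :
  (forall e, ontological e -> oeval e A) -> L1 A.
Proof.
move=> A_true; apply: contrapT => nLA.
have L1_th : classical_theory Oneg Oor L1 by split; [exact: L1_classical | exact: L1_mp].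
have [M [LM nMA Mneg Mor]] := lindenbaum L1_th nLA.
have evalM B : oeval (fun a b => M (Oeps a b)) B <-> M B.
  by elim: B => [//|B IH|B IHB C IHC] /=; [rewrite IH Mneg | rewrite IHB IHC Mor].
have Mmp B C : L1 (Oimp B C) -> M B -> M C.
  by move=> /LM /Mor[/Mneg|].
have Mand B C : M B -> M C -> M (Oand B C).
  by move=> MB MC; apply/Mneg => /Mor[] /Mneg.
apply/nMA/evalM/A_true; split=> [a b|a b c ab bc|a b c ab bc].
- exact/Mmp/L1_ax1.
- by apply: (Mmp (Oand (Oeps a b) (Oeps b c))); [exact: L1_ax2 | exact: Mand].
- by apply: (Mmp (Oand (Oeps a b) (Oeps b c))); [exact: L1_ax3 | exact: Mand].
Qed.

Fixpoint max_name (A : oform) : nat :=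
  match A with
  | Oeps a b => maxn a b
  | Oneg B => max_name B
  | Oor B C => maxn (max_name B) (max_name C)
  end.

Section Forcing.
Variables (U : Type) (fr : kframe U) (V : propvar -> set U).

Lemma forces_Mimp (w : U) (A B : mform) :
  forces fr V w (Mimp A B) <-> (forces fr V w A -> forces fr V w B).
Proof.
split=> [/= [nA|] //|AB]; have [fA|nA] := pselect (forces fr V w A).
  by right; exact: AB.
by left.
Qed.

Lemma forces_Mand (w : U) (A B : mform) :
  forces fr V w (Mand A B) <-> forces fr V w A /\ forces fr V w B.
Proof.
rewrite /Mand /pconj /=; split=> [/not_orP[/contrapT fA /contrapT fB] //|].
by move=> [fA fB] [].
Qed.

Lemma forces_box_imp (w : U) (q r : propvar) :
  forces fr V w (Mbox (Mimp (Mvar q) (Mvar r))) <->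
  (forall v, acc fr (w, v) -> V q v -> V r v).
Proof.
split=> wqr v wv; have [mp im] := forces_Mimp v (Mvar q) (Mvar r).
  exact: mp (wqr v wv).
exact: im (wqr v wv).
Qed.

End Forcing.

(** Boxes in a B-translation stand only before implications between variables, so its truth at [w]
    depends just on the valuation at [w] and its successors. There the box of [p a] implying [p b]
    says that [e j a] implies [e j b] for all [j <= i]. *)
Lemma forces_Btrans_fan (p : name -> propvar) (U : Type) (fr : kframe U)
    (V : propvar -> set U) (e : name -> name -> Prop) (w : U) (g : nat -> U)
    (i : nat) :
    ontological e ->
    (forall v, acc fr (w, v) <-> exists2 j, j <= i & v = g j) ->
    (forall a, V (p a) w <-> e a a) ->
    (forall a j, j <= i -> V (p a) (g j) <-> e j a) ->
  forall A, max_name A <= i -> forces fr V w (Btrans p A) <-> oeval e A.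
Proof.
move=> [ax1 ax2 ax3] w_acc Vw Vg.
have boxE a b : forces fr V w (Mbox (Mimp (Mvar (p a)) (Mvar (p b)))) <->
    (forall j, j <= i -> e j a -> e j b).
  rewrite forces_box_imp; split=> [ab j ji|ab v /w_acc[j ji ->]].
    by move=> /(Vg _ _ ji) ja; apply/(Vg _ _ ji)/ab => //; apply/w_acc; exists j.
  by move=> /(Vg _ _ ji) ja; apply/(Vg _ _ ji)/ab.
elim=> [a b|B IH|B IHB C IHC] le_i.
- move: le_i; rewrite geq_max => /andP[ai bi].
  rewrite [Btrans _ _]/= 2!forces_Mand forces_Mimp !boxE /= !Vw.
  (* As [a <= i], the instance [j = a] turns [e a a] into [e a b]. *)
  split=> [[[aa ab] _]|ab]; first exact: ab.
  split; first by split=> [|j _ ja]; [exact: ax1 ab | exact: ax2 ja ab].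
  (* Ax3 gives [e b a] from [e a b] and [e b b]; Ax2 then carries [e j b] to [e j a]. *)
  by move=> bb j _ jb; apply: ax2 jb _; exact: ax3 ab bb.
- by rewrite /= IH.
- by move: le_i; rewrite geq_max => /andP[Bi Ci]; rewrite /= IHB // IHC.
Qed.

Theorem theorem6p1 (p : name -> propvar) (p_inj : injective p)
  (X : set mform) (X_normal : normal_logic X)
  (I : Type) (omega : nat -> I) (omega_inj : injective omega)
  (U : Type) (F : I -> kframe U)
  (F_infinite : forall alpha : I, infinite_set (world (F alpha)))
  (X_complete : complete_wrt X (range F))
  (H : nat -> kframe U) (star : U) (g : nat -> U) (eta : nat -> nat -> U)
  (eta_card : forall i : nat, (range (eta i) #= [set: nat])%card)
  (eta_disj : forall i : nat,
     ([set star] `|` g @` [set j | (j <= i)%N]) `&` range (eta i) = set0)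
  (star_g : forall i j : nat, (j <= i)%N -> star <> g j)
  (g_distinct : forall i j k : nat, (j <= i)%N -> (k <= i)%N -> g j = g k -> j = k)
  (H_world : forall i : nat,
     world (H i) = ([set star] `|` g @` [set j | (j <= i)%N]) `|` range (eta i))
  (H_acc : forall i : nat,
     acc (H i) = [set (star, g j) | j in [set j | (j <= i)%N]]
                 `|` [set (x, x) | x in range (eta i)])
  (H_sub_F : range H `<=` range F) :
  B_faithful p X.
Proof.
move=> A XA; apply: L1_complete => e e_ont; pose i := max_name A.
(* Variables outside the range of [p] are false everywhere; injectivity of [p] recovers the name
   from its variable. *)
pose V q := [set w : U | exists2 a, q = p a &
  (w = star /\ e a a) \/ exists j, [/\ j <= i, w = g j & e j a]].
have [alpha _ FH] : range F (H i) by apply: H_sub_F; exists i.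
have HA : valid (H i) (Btrans p A).
  by apply: (X_complete _).1 => //; exists alpha.
have Hstar : world (H i) star by rewrite H_world; left; left.
suff fan : forces (H i) V star (Btrans p A) <-> oeval e A by exact/fan/HA.
apply: (@forces_Btrans_fan p U (H i) V e star g i) => // [v|a|a j ji].
- rewrite H_acc; split=> [[[j ji [<-]]|[x xeta [xstar _]]]|[j ji ->]].
  + by exists j.
  (* A loop at [star] would put [star] in the range of [eta i], against [eta_disj]. *)
  + suff : (set0 : set U) x by [].
    by rewrite -(eta_disj i); split=> //; left; rewrite xstar.
  + by left; exists j.
- split=> [[b /p_inj <- [[_ //]|[j [ji sg _]]]]|aa]; last by exists a => //; left.
  by have := star_g _ _ ji.
(* The world [g j] is not [star], and distinctness of the [g] up to [i] forces [k = j]. *)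
- split=> [[b /p_inj <- [[gs _]|[k [ki gg ka]]]]|ja].
  + by have := star_g _ _ ji; rewrite gs.
  + by rewrite (g_distinct _ _ _ ji ki gg).
  + by exists a => //; right; exists j.
Qed.
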